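(* Let $r$, $t$, and $v$ be positive integers with $t\geq 2r$. An $r$-$\mathrm{SFPC}(v,t)$ (an $r$-secure frameproof code of length $v$ and size $t$) exists if and only if there exists a biclique cover of size $v$ of the Kneser graph $\mathrm{KG}(t,r)$.
   Context: All graphs are finite and simple. Secure frameproof codes. A $(v,t)$-code is a set $\Gamma\subseteq\{0,1\}^v$ with $|\Gamma|=t$. For a nonempty $C\subseteq\Gamma$, a coordinate $i\in\{1,\ldots,v\}$ is undetectable for $C$ if all words of $C$ have the same $i$th component; $U(C)$ is the set of undetectable coordinates for $C$, and $F(C)=\{x\in\{0,1\}^v : x|_{U(C)}=w|_{U(C)}\text{ for all } w\in C\}$. The code $\Gamma$ is an $r$-secure frameproof code, written $r$-$\mathrm{SFPC}(v,t)$, if for all nonempty $C_1,C_2\subseteq\Gamma$ with $|C_1|\le r$, $|C_2|\le r$ and $C_1\cap C_2=\varnothing$, one has $F(C_1)\cap F(C_2)=\varnothing$. Kneser graph. $[t]=\{1,\ldots,t\}$. The vertices of $\mathrm{KG}(t,r)$ are the $r$-element subsets of $[t]$; two distinct vertices $A,B$ are adjacent iff $A\cap B=\varnothing$. Biclique covers. A biclique is a bipartite graph with parts $(X,Y)$ in which every vertex of $X$ is adjacent to every vertex of $Y$; edgeless (empty) graphs are also regarded as bicliques. A biclique cover of size $v$ of a graph $G$ is a collection (family $G_1,\ldots,G_v$, repetitions allowed) of $v$ bicliques that are subgraphs (not necessarily induced) of $G$, such that each edge of $G$ is in at least one of them. *)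

(* Defs.v *)
From mathcomp Require Import all_boot.

Set Implicit Arguments.
Unset Strict Implicit.
Unset Printing Implicit Defensive.

Definition word (v : nat) := {ffun 'I_v -> bool}.

Definition undetectable (v : nat) (C : {set word v}) : {set 'I_v} :=
  [set i | [forall w1 in C, forall w2 in C, w1 i == w2 i]].

Definition feasible (v : nat) (C : {set word v}) : {set word v} :=
  [set x : word v |
     [forall w in C, forall i in undetectable C, x i == w i]].

Definition is_SFPC (r v t : nat) (Gamma : {set word v}) : Prop :=
  #|Gamma| = t /\
  forall C1 C2 : {set word v},
    C1 \subset Gamma -> C2 \subset Gamma ->
    C1 != set0 -> C2 != set0 ->
    #|C1| <= r -> #|C2| <= r ->
    C1 :&: C2 = set0 ->
    feasible C1 :&: feasible C2 = set0.

(* A finite simple graph whose vertex set is a subset of the ambient finite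
   type T, so that the subgraphs of a graph live over the same T. *)
Record sgraph (T : finType) := SGraph {
  vertices : {set T};
  adj : rel T;
  adj_sym : symmetric adj;
  adj_irrefl : irreflexive adj;
  adj_vertices : forall x y, adj x y -> (x \in vertices) && (y \in vertices)
}.

Definition subgraph (T : finType) (H G : sgraph T) : Prop :=
  vertices H \subset vertices G /\ forall x y, adj H x y -> adj G x y.

Definition edgeless (T : finType) (H : sgraph T) : Prop :=
  forall x y, ~~ adj H x y.

Definition complete_bipartite (T : finType) (H : sgraph T) (X Y : {set T}) :
    Prop :=
  [/\ X :&: Y = set0, X :|: Y = vertices H &
      forall x y, adj H x y =
        (x \in X) && (y \in Y) || (x \in Y) && (y \in X)].

Definition biclique (T : finType) (H : sgraph T) : Prop :=
  (exists X Y : {set T}, complete_bipartite H X Y) \/ edgeless H.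

(* The cover is an indexed family, so a biclique may be repeated. *)
Definition biclique_cover (T : finType) (G : sgraph T) (v : nat)
    (H : 'I_v -> sgraph T) : Prop :=
  [/\ forall i, biclique (H i), forall i, subgraph (H i) G &
      forall x y, adj G x y -> exists i, adj (H i) x y].

Section Kneser.
Variables t r : nat.

Definition kneser_vertices : {set {set 'I_t}} := [set A : {set 'I_t} | #|A| == r].

Definition kneser_adj : rel {set 'I_t} := fun A B =>
  [&& A \in kneser_vertices, B \in kneser_vertices, A != B &
      A :&: B == set0].

Lemma kneser_adj_sym : symmetric kneser_adj.
Proof. by move=> A B; rewrite /kneser_adj eq_sym setIC andbCA. Qed.

Lemma kneser_adj_irrefl : irreflexive kneser_adj.
Proof. by move=> A; rewrite /kneser_adj eqxx !andbF. Qed.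

Lemma kneser_adj_vertices A B :
  kneser_adj A B -> (A \in kneser_vertices) && (B \in kneser_vertices).
Proof. by case/and4P=> -> ->. Qed.

Definition KG : sgraph {set 'I_t} :=
  SGraph kneser_adj_sym kneser_adj_irrefl kneser_adj_vertices.

End Kneser.

(* Main.v *)
Require Import Defs.
From mathcomp Require Import all_boot.

(** Both sides of the equivalence describe a [t]-indexed family of words in
    which any two disjoint [r]-subsets of the index set are told apart by one
    coordinate: the coordinate is constant on each subset, with opposite values.

    For a code this is a reformulation of secure frameproofness
    ([disjoint_feasibleP]): [feasible C1] and [feasible C2] are subcubes, obtained
    by fixing the undetectable coordinates, and two subcubes are disjoint
    exactly when some coordinate is fixed in both, to different values.

    For a cover, the coordinates are the bicliques.  A coordinate of a family of
    words yields the biclique between the [r]-subsets on which it is constantly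
    true and those on which it is constantly false; these are disjoint because
    they are nonempty.  Conversely, if a biclique with parts [X], [Y] lies in
    the Kneser graph, then every member of [X] is disjoint from every member of
    [Y], so the union of [X] is disjoint from the union of [Y], and the
    indicator function of the latter is a coordinate that separates every edge
    of the biclique ([biclique_coordinate]).

    A code also has to separate disjoint subsets with fewer than [r] elements:
    as [2 * r <= t], these extend to disjoint [r]-subsets
    ([extend_disjoint_pair]).  Applied to singletons, this also shows that the
    words built from a cover are pairwise distinct. *)

Set Implicit Arguments.
Unset Strict Implicit.
Unset Printing Implicit Defensive.

(** * Separation by a coordinate *)

(** Indexing the words by a finite type, rather than working with sets of words,
    lets the same notion serve codes and vertices of the Kneser graph. *)
Definition separated (I : finType) (v : nat) (f : I -> word v)
    (A B : {set I}) : Prop :=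
  exists i b, {in A, forall a, f a i = b} /\ {in B, forall a, f a i = ~~ b}.

Lemma undetectableP (v : nat) (C : {set word v}) (i : 'I_v) :
  reflect {in C &, forall w1 w2 : word v, w1 i = w2 i} (i \in undetectable C).
Proof.
rewrite inE; apply: (iffP forall_inP) => [h w1 w2 C1 C2 | h w1 C1].
  by apply/eqP; apply: (forall_inP (h w1 C1)).
by apply/forall_inP => w2 C2; apply/eqP/h.
Qed.

Lemma feasibleP (v : nat) (C : {set word v}) (x : word v) :
  reflect {in C & undetectable C, forall (w : word v) i, x i = w i} (x \in feasible C).
Proof.
rewrite [x \in _]inE; apply: (iffP forall_inP) => [h w i Cw Ui | h w Cw].
  by apply/eqP; apply: (forall_inP (h w Cw)).
by apply/forall_inP => i Ui; apply/eqP/h.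
Qed.

(** If no coordinate is fixed in both subcubes to different values, then a word
    that follows the first on its fixed coordinates and the second elsewhere
    lies in both of them. *)
Lemma disjoint_feasibleP (I : finType) (v : nat) (f : I -> word v)
    (A B : {set I}) (a0 b0 : I) :
  a0 \in A -> b0 \in B ->
  feasible (f @: A) :&: feasible (f @: B) = set0 <-> separated f A B.
Proof.
move=> Aa0 Bb0; split=> [disj | [i [b [fA fB]]]]; last first.
  have UA : i \in undetectable (f @: A).
    by apply/undetectableP => _ _ /imsetP[a Aa ->] /imsetP[a' Aa' ->]; rewrite !fA.
  have UB : i \in undetectable (f @: B).
    by apply/undetectableP => _ _ /imsetP[a Ba ->] /imsetP[a' Ba' ->]; rewrite !fB.
  apply/setP => x; rewrite in_setI in_set0; apply/negP => /andP[/feasibleP xA /feasibleP xB].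
  have := xB _ i (imset_f f Bb0) UB.
  by rewrite (xA _ i (imset_f f Aa0) UA) fA // fB //; case: b {fA fB}.
set UA := undetectable (f @: A); set UB := undetectable (f @: B).
have [/existsP[i /and3P[/undetectableP hA /undetectableP hB neq]] | none] :=
  boolP [exists i, [&& i \in UA, i \in UB & f a0 i != f b0 i]].
  exists i, (f a0 i); split=> a aIn; first by apply: hA; apply: imset_f.
  rewrite (hB (f a) (f b0)) ?imset_f //.
  by case: (f a0 i) (f b0 i) neq => [] [].
pose x : word v := [ffun i => if i \in UA then f a0 i else f b0 i].
suff : x \in set0 by rewrite in_set0.
rewrite -disj in_setI; apply/andP; split; apply/feasibleP => w i Cw Ui.
  by rewrite ffunE Ui; apply: (undetectableP _ _ Ui) => //; apply: imset_f.
have -> : w i = f b0 i by apply: (undetectableP _ _ Ui) => //; apply: imset_f.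
rewrite ffunE; case: ifP => // UAi; apply/eqP; apply: contraNT none => neq.
by apply/existsP; exists i; apply/and3P.
Qed.

(** * Enlarging disjoint sets *)

Lemma subset_of_card (T : finType) (A D : {set T}) (n : nat) :
  A \subset D -> #|A| <= n <= #|D| ->
  exists E : {set T}, [/\ A \subset E, E \subset D & #|E| = n].
Proof.
move=> sAD /andP[leAn lenD].
pose s := take (n - #|A|) (enum (D :\: A)).
have sD x : x \in s -> x \in D :\: A by move/mem_take; rewrite mem_enum.
exists (A :|: [set x in s]); split; first exact: subsetUl.
  rewrite subUset sAD; apply/subsetP => x; rewrite inE => /sD.
  by rewrite inE => /andP[].
have -> : #|A :|: [set x in s]| = #|A| + #|[set x in s]|.
  apply/eqP; rewrite (leq_card_setU A [set x in s]) -setI_eq0.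
  apply/eqP/setP => x; rewrite !inE; apply/negP => /andP[Ax /sD].
  by rewrite inE Ax.
rewrite cardsE (card_uniqP _) ?take_uniq ?enum_uniq // size_takel ?subnKC //.
by rewrite -cardE cardsD (setIidPr sAD) leq_sub2r.
Qed.

(** [A] is enlarged inside the complement of [B], then [B] inside the complement
    of the enlarged [A]; each complement has at least [#|T| - r >= r] elements. *)
Lemma extend_disjoint_pair (T : finType) (r : nat) (A B : {set T}) :
  2 * r <= #|T| -> A :&: B = set0 -> #|A| <= r -> #|B| <= r ->
  exists A' B' : {set T},
    [/\ A \subset A', B \subset B', #|A'| = r, #|B'| = r & A' :&: B' = set0].
Proof.
rewrite mul2n -addnn => leT AB0 leA leB.
have cC (E : {set T}) : #|E| <= r -> r <= #|~: E|.
  by move=> leE; rewrite cardsCs setCK leq_subRL ?(leq_trans _ leT) //;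
    rewrite ?leq_add2r // (leq_trans leE) ?leq_addr.
have [|| A' [sAA' sA'B cA']] := @subset_of_card T A (~: B) r.
- by rewrite -disjoints_subset -setI_eq0 AB0.
- by rewrite leA cC.
have [|| B' [sBB' sB'A cB']] := @subset_of_card T B (~: A') r.
- by rewrite -setCS setCK.
- by rewrite leB cC ?cA'.
exists A', B'; split=> //; apply/eqP.
by rewrite setI_eq0 disjoint_sym disjoints_subset.
Qed.

(** * From coordinates to bicliques *)

Section CompleteBipartiteGraph.

Variables (T : finType) (X Y : {set T}).
Hypothesis XY0 : X :&: Y = set0.

Let edge : rel T := fun x y => (x \in X) && (y \in Y) || (x \in Y) && (y \in X).

Let edge_sym : symmetric edge.
Proof. by move=> x y; rewrite /edge orbC andbC [_ && (y \in Y)]andbC. Qed.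

Let edge_irrefl : irreflexive edge.
Proof. by move=> x; rewrite /edge [(_ \in Y) && _]andbC -in_setI XY0 inE. Qed.

Let edge_vertices x y : edge x y -> (x \in X :|: Y) && (y \in X :|: Y).
Proof. by rewrite !inE => /orP[] /andP[-> ->]; rewrite ?orbT. Qed.

Definition complete_bipartite_graph : sgraph T :=
  SGraph edge_sym edge_irrefl edge_vertices.

Lemma complete_bipartite_graph_biclique : biclique complete_bipartite_graph.
Proof. by left; exists X, Y; split. Qed.

End CompleteBipartiteGraph.

Lemma kneser_adjP (t r : nat) (A B : {set 'I_t}) : 0 < r ->
  reflect [/\ #|A| = r, #|B| = r & A :&: B = set0] (adj (KG t r) A B).
Proof.
move=> r0; rewrite /= /kneser_adj !inE.
apply: (iffP and4P) => [[/eqP-> /eqP-> _ /eqP->] | [cA cB AB0]] //.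
rewrite cA cB AB0 !eqxx; split=> //; apply/eqP => eAB.
by move: AB0 r0; rewrite -cA -eAB setIid => ->; rewrite cards0.
Qed.

Section MonochromaticSets.

Variables (r t v : nat) (f : 'I_t -> word v) (i : 'I_v).

Definition monochromatic (b : bool) : {set {set 'I_t}} :=
  [set A : {set 'I_t} | (#|A| == r) && [forall a in A, f a i == b]].

Lemma monochromaticP (b : bool) (A : {set 'I_t}) :
  reflect (#|A| = r /\ {in A, forall a, f a i = b}) (A \in monochromatic b).
Proof.
rewrite inE; apply: (iffP andP) => [[/eqP-> /forall_inP h]|[-> h]]; split=> //.
  by move=> a /h/eqP.
by apply/forall_inP => a /h ->.
Qed.

Lemma monochromatic_disjoint (b : bool) (A B : {set 'I_t}) :
  A \in monochromatic b -> B \in monochromatic (~~ b) -> A :&: B = set0.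
Proof.
move=> /monochromaticP[_ hA] /monochromaticP[_ hB].
apply/setP => a; rewrite !inE; apply/negP => /andP[/hA fa /hB].
by rewrite fa; case: b {hA hB fa}.
Qed.

Lemma monochromatic_adj (b : bool) (A B : {set 'I_t}) : 0 < r ->
  A \in monochromatic b -> B \in monochromatic (~~ b) -> adj (KG t r) A B.
Proof.
move=> r0 mA mB; apply/kneser_adjP => //.
have [cA _] := monochromaticP _ _ mA; have [cB _] := monochromaticP _ _ mB.
by split=> //; apply: monochromatic_disjoint mA mB.
Qed.

Lemma monochromatic_parts_disjoint :
  0 < r -> monochromatic true :&: monochromatic false = set0.
Proof.
move=> r0; apply/setP => A; rewrite in_setI in_set0; apply/negP => /andP[At Af].
have := monochromatic_disjoint At Af; rewrite setIid => A0.
by case/monochromaticP: At r0 => <-; rewrite A0 cards0.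
Qed.

End MonochromaticSets.

Lemma cover_of_separated (r t v : nat) (f : 'I_t -> word v) :
  0 < r ->
  (forall A B, adj (KG t r) A B -> separated f A B) ->
  exists H : 'I_v -> sgraph {set 'I_t}, biclique_cover (KG t r) H.
Proof.
move=> r0 sep.
exists (fun i => complete_bipartite_graph (monochromatic_parts_disjoint f i r0)).
split=> [i | i | A B adjAB].
- exact: complete_bipartite_graph_biclique.
- split=> [|A B /orP[] /andP[mA mB]].
    by apply/subsetP => A; rewrite in_setU => /orP[] /monochromaticP[cA _];
      rewrite inE cA.
    exact: monochromatic_adj r0 mA mB.
  exact: monochromatic_adj r0 mA mB.
- have /(kneser_adjP _ _ r0)[cA cB _] := adjAB.
  have [i [b [fA fB]]] := sep A B adjAB; exists i.
  have mA : A \in monochromatic r f i b by apply/monochromaticP.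
  have mB : B \in monochromatic r f i (~~ b) by apply/monochromaticP.
  by case: b mA mB {fA fB} => /= mA mB; apply/orP; [left | right]; rewrite mA mB.
Qed.

(** * From bicliques to coordinates *)

(** An edgeless graph is treated as a biclique with two empty parts. *)
Lemma biclique_parts (T : finType) (H : sgraph T) : biclique H ->
  exists X Y : {set T}, forall x y,
    adj H x y = (x \in X) && (y \in Y) || (x \in Y) && (y \in X).
Proof.
case=> [[X [Y [_ _ e]]] | e]; first by exists X, Y.
by exists set0, set0 => x y; rewrite !inE; apply/negbTE/e.
Qed.

(** The coordinate is the indicator of the union of the part [Y]; it vanishes
    on every member of [X] since members of opposite parts are disjoint. *)
Lemma biclique_coordinate (r t : nat) (H : sgraph {set 'I_t}) : 0 < r ->
  biclique H -> subgraph H (KG t r) ->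
  exists g : 'I_t -> bool, forall A B, adj H A B ->
    exists b, {in A, forall a, g a = b} /\ {in B, forall a, g a = ~~ b}.
Proof.
move=> r0 /biclique_parts[X [Y eH]] [_ sub].
have onY A : A \in Y -> {in A, forall a, a \in cover Y}.
  by move=> YA a Aa; apply/bigcupP; exists A.
have onX A : A \in X -> {in A, forall a, (a \in cover Y) = false}.
  move=> XA a Aa; apply/negP => /bigcupP[B YB Ba].
  have /sub/(kneser_adjP _ _ r0)[_ _ /setP/(_ a)] : adj H A B.
    by rewrite eH XA YB.
  by rewrite !inE Aa Ba.
exists (mem (cover Y)) => A B; rewrite eH => /orP[] /andP[hA hB].
  by exists false; split; [apply: onX | apply: onY].
by exists true; split; [apply: onY | apply: onX].
Qed.

Lemma separated_of_cover (r t v : nat) (H : 'I_v -> sgraph {set 'I_t}) :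
  0 < r -> biclique_cover (KG t r) H ->
  exists f : 'I_t -> word v,
    forall A B, adj (KG t r) A B -> separated f A B.
Proof.
move=> r0 [biH subH covH].
have [g gP] := fin_all_exists (fun i => biclique_coordinate r0 (biH i) (subH i)).
exists (fun a => [ffun i => g i a]) => A B /covH[i /gP[b [gA gB]]].
by exists i, b; split=> a aIn; rewrite ffunE; [apply: gA | apply: gB].
Qed.

(** * Codes as separating families *)

Lemma separated_of_SFPC (r t v : nat) (Gamma : {set word v}) :
  0 < r -> is_SFPC r t Gamma ->
  exists f : 'I_t -> word v,
    forall A B, adj (KG t r) A B -> separated f A B.
Proof.
move=> r0 [cG secure].
pose f (a : 'I_t) : word v := enum_val (cast_ord (esym cG) a).
have f_inj : injective f by move=> a b /enum_val_inj/cast_ord_inj.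
exists f => A B /(kneser_adjP _ _ r0)[cA cB AB0].
have /set0Pn[a Aa] : A != set0 by rewrite -card_gt0 cA.
have /set0Pn[b Bb] : B != set0 by rewrite -card_gt0 cB.
have subG (E : {set 'I_t}) : f @: E \subset Gamma.
  by apply/subsetP => _ /imsetP[c _ ->]; apply: enum_valP.
apply/(disjoint_feasibleP f Aa Bb); apply: secure => //.
- by apply/set0Pn; exists (f a); apply: imset_f.
- by apply/set0Pn; exists (f b); apply: imset_f.
- by rewrite card_imset ?cA.
- by rewrite card_imset ?cB.
- by rewrite -imsetI ?AB0 ?imset0 // => x y _ _ /f_inj.
Qed.

Lemma separated_disjoint (r t v : nat) (f : 'I_t -> word v)
    (A B : {set 'I_t}) :
  0 < r -> 2 * r <= t ->
  (forall A' B', adj (KG t r) A' B' -> separated f A' B') ->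
  #|A| <= r -> #|B| <= r -> A :&: B = set0 -> separated f A B.
Proof.
move=> r0 htr sep leA leB AB0.
have [|A' [B' [sA sB cA cB AB'0]]] := extend_disjoint_pair _ AB0 leA leB.
  by rewrite card_ord.
have [|i [b [fA fB]]] := sep A' B'; first exact/(kneser_adjP _ _ r0).
by exists i, b; split=> a aIn; [apply/fA/(subsetP sA) | apply/fB/(subsetP sB)].
Qed.

Lemma SFPC_of_separated (r t v : nat) (f : 'I_t -> word v) :
  0 < r -> 2 * r <= t ->
  (forall A B, adj (KG t r) A B -> separated f A B) ->
  is_SFPC r t (f @: setT).
Proof.
move=> r0 htr sep.
(* Two equal words would not be separated as singletons. *)
have f_inj : injective f.
  move=> a b eqf; apply/eqP; apply: contraT => neq.
  have [|||i [c [fa fb]]] :=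
    @separated_disjoint r t v f [set a] [set b] r0 htr sep; rewrite ?cards1 //.
    apply/setP => x; rewrite !inE; apply/negP => /andP[/eqP-> eqab].
    by rewrite eqab in neq.
  have := fb b (set11 b); rewrite -eqf (fa a (set11 a)).
  by case: (c).
split=> [|C1 C2 sC1 sC2 C1n0 C2n0 leC1 leC2 C120].
  by rewrite card_imset // cardsT card_ord.
have preK (C : {set word v}) : C \subset f @: setT -> f @: (f @^-1: C) = C.
  move=> sC; apply/setP => w; apply/imsetP/idP => [[a Ca ->] | Cw].
    by rewrite inE in Ca.
  have /imsetP[a _ ea] := subsetP sC _ Cw.
  by exists a; rewrite // inE -ea.
rewrite -(preK C1 sC1) in C1n0 leC1 *; rewrite -(preK C2 sC2) in C2n0 leC2 *.
case/set0Pn: C1n0 => _ /imsetP[a Aa _]; case/set0Pn: C2n0 => _ /imsetP[b Bb _].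
apply/(disjoint_feasibleP f Aa Bb).
apply: (@separated_disjoint r) => //; first by rewrite -(card_imset _ f_inj).
  by rewrite -(card_imset _ f_inj).
by rewrite -preimsetI C120 preimset0.
Qed.

Theorem theorem1 (r t v : nat) (hr : 0 < r) (ht : 0 < t) (hv : 0 < v)
    (htr : 2 * r <= t) :
  (exists Gamma : {set word v}, is_SFPC r t Gamma) <->
  (exists H : 'I_v -> sgraph {set 'I_t}, biclique_cover (KG t r) H).
Proof.
split=> [[Gamma secure] | [H cov]].
  have [f sep] := separated_of_SFPC hr secure.
  exact: cover_of_separated sep.
have [f sep] := separated_of_cover hr cov.
by exists (f @: setT); apply: SFPC_of_separated.
Qed.
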